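(* Let $A$ be an algebra over $k$ and let $\Sigma^{\min}$ be the minimal summability structure on $A$. Then the summability algebra $(A,\Sigma^{\min})$ has evaluations if and only if $A$ is locally nilpotent.
   Context: $k$ is a fixed associative, commutative, unital $\mathbb{Q}$-algebra. An algebra is a $k$-module with a $k$-bilinear product (not assumed associative or unital). The minimal summability structure $\Sigma^{\min}$ on a $k$-module $V$: for each set $I$, the summable families $I\to V$ are exactly the finitely supported ones, and their sum $\Sigma^{\min}_I v$ is the finite sum of the non-zero terms. For an algebra $A$: $A_1=A$ and, for $n>0$, $A_{n+1}$ is the submodule generated by all $a\cdot b$ and $b\cdot a$ with $a\in A_i$, $b\in A_{n+1-i}$, $1\le i\le n$. $A$ is nilpotent if $A_{m+1}=\{0\}$ for some $m>0$, and locally nilpotent if every finitely generated subalgebra of $A$ is nilpotent. For a set $I$, $I^{(\star)}$ is the free non-associative monoid on $I$ (non-associative words, including the empty word $\varnothing$ as identity). $k\langle\!\langle I\rangle\!\rangle^{\mathrm{na}}$ is the module of all functions $P:I^{(\star)}\to k$ with product $(P\cdot Q)(w)=\sum_{(uv)=w}P(u)Q(v)$; a family $(P_j)_{j\in J}$ in it is summable iff for each word $w$ the set $\{j:P_j(w)\neq0\}$ is finite, with pointwise sum. $X_i$ is the indicator function of the word $i$, and $k\langle\!\langle I\rangle\!\rangle^{\mathrm{na}}_0=\{P:P(\varnothing)=0\}$, with the restricted notion of summability. A $k$-linear map $\phi$ between modules with a notion of summable families and sums is strongly linear if for every summable $v:I\to V$, $\phi\circ v$ is summable and its sum is $\phi(\Sigma_Iv)$.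 A summability algebra $A$ has evaluations if for every set $I$ and every summable $a:I\to A$ there is a strongly linear morphism of algebras $\mathrm{ev}_a:k\langle\!\langle I\rangle\!\rangle^{\mathrm{na}}_0\to A$ with $\mathrm{ev}_a(X_i)=a(i)$ for all $i\in I$. *)

(* Defs.v *)
From HB Require Import structures.
From mathcomp Require Import all_boot all_order all_algebra.
From mathcomp Require Import finmap.
From mathcomp Require Import boolp classical_sets functions cardinality fsbigop.

Set Implicit Arguments.
Unset Strict Implicit.
Unset Printing Implicit Defensive.

Import GRing.Theory.

Local Open Scope classical_set_scope.
Local Open Scope ring_scope.

(** * Non-associative, non-unital algebras *)

(* [{bilinear A -> A -> A}] from sesquilinear.v requires a nonzero ring; here
   the zero ring is allowed as a base ring. *)
HB.mixin Record Lmodule_isNAAlgebra (k : comPzRingType) A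
    of GRing.Lmodule k A := {
  namul : A -> A -> A;
  namul_linearl : forall b : A, linear (namul^~ b);
  namul_linearr : forall a : A, linear (namul a)
}.

#[short(type="naAlgType")]
HB.structure Definition NAAlgebra (k : comPzRingType) :=
  {A of GRing.Lmodule k A & Lmodule_isNAAlgebra k A}.

Definition namultiplicative (k : comPzRingType) (A B : naAlgType k)
    (f : A -> B) : Prop :=
  {morph f : a b / namul a b >-> namul a b}.

Section LocallyNilpotent.
Variables (k : comPzRingType) (A : naAlgType k).
Implicit Types (B M S : set A) (a b x y : A).

Definition submodule M : Prop :=
  [/\ M 0, forall x y, M x -> M y -> M (x + y)
         & forall (c : k) x, M x -> M (c *: x)].

Definition subalgebra B : Prop :=
  submodule B /\ (forall a b, B a -> B b -> B (namul a b)).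

Definition submodule_gen S : set A := smallest submodule S.

Definition subalgebra_gen S : set A := smallest subalgebra S.

Definition finitely_generated B : Prop :=
  exists2 S, finite_set S & B = subalgebra_gen S.

(* [alg_power B n] is B_n for a subalgebra B of A, and is empty for n = 0.
   Since B is a submodule of A, the submodules of B generated by a set can be
   computed in A. Lemma [alg_powerS] is the recursion B_{n+1}. *)
Inductive alg_power B : nat -> A -> Prop :=
| alg_power_1 x : B x -> alg_power B 1 x
| alg_power_mul n i a b : (0 < i <= n)%N ->
    alg_power B i a -> alg_power B (n.+1 - i) b ->
    alg_power B n.+1 (namul a b)
| alg_power_mulC n i a b : (0 < i <= n)%N ->
    alg_power B i a -> alg_power B (n.+1 - i) b ->
    alg_power B n.+1 (namul b a)
| alg_power_0 n : (0 < n)%N -> alg_power B n.+1 0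
| alg_power_add n x y : (0 < n)%N ->
    alg_power B n.+1 x -> alg_power B n.+1 y -> alg_power B n.+1 (x + y)
| alg_power_scale n (c : k) x : (0 < n)%N ->
    alg_power B n.+1 x -> alg_power B n.+1 (c *: x).

Lemma alg_power1 B : alg_power B 1 = B.
Proof.
apply/seteqP; split=> x; last exact: alg_power_1.
move E: 1%N => n Bx; case: Bx E => //.
- by move=> m i a b + _ _ [m0]; rewrite -m0 ltnNge; case: (i == 0)%N; case: i.
- by move=> m i a b + _ _ [m0]; rewrite -m0 ltnNge; case: (i == 0)%N; case: i.
- by move=> m + [m0]; rewrite -m0.
- by move=> m ? ? + _ _ [m0]; rewrite -m0.
- by move=> m ? ? + _ [m0]; rewrite -m0.
Qed.

Lemma alg_powerS B n : (0 < n)%N ->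
  alg_power B n.+1 = submodule_gen
    [set x | exists i a b, [/\ (1 <= i <= n)%N, alg_power B i a,
       alg_power B (n.+1 - i) b & x = namul a b \/ x = namul b a]].
Proof.
move=> n0; apply/seteqP; split=> x.
- move E: n.+1 => m Bx; elim: Bx n n0 E => {m x}.
  + by move=> x _ n n0 [E]; rewrite E in n0.
  + move=> n i a b hi Ba _ Bb _ m _ [->] M [_]; apply.
    by exists i, a, b; split=> //; left.
  + move=> n i a b hi Ba _ Bb _ m _ [->] M [_]; apply.
    by exists i, a, b; split=> //; right.
  + by move=> n _ m _ _ M [[]].
  + move=> n x y _ _ IHx _ IHy m m0 E M /= [sM sub].
    by case: (sM) => _ MD _; apply: MD; [exact: (IHx m)|exact: (IHy m)].
  + move=> n c x _ _ IHx m m0 E M /= [sM sub].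
    by case: (sM) => _ _; apply; exact: (IHx m).
- apply; split; first split.
  + exact: alg_power_0.
  + by move=> u v; exact: alg_power_add.
  + by move=> c u; exact: alg_power_scale.
  + move=> _ [i [a [b [hi Ba Bb [->|->]]]]]; first exact: alg_power_mul Ba Bb.
    exact: alg_power_mulC Ba Bb.
Qed.

Definition nilpotent B : Prop :=
  exists2 m : nat, (0 < m)%N & alg_power B m.+1 = [set 0].

Definition locally_nilpotent : Prop :=
  forall B, finitely_generated B -> nilpotent B.

End LocallyNilpotent.

(** * Notions of summability *)

(* Only the data of a summability structure; [ssum v] is meaningful only when
   [summable v] holds. *)
Record summability (k : comPzRingType) (V : lmodType k) := Summability {
  summable : forall I : Type, (I -> V) -> Prop;
  ssum : forall I : Type, (I -> V) -> V
}.
Arguments summable {k V} _ {I} _.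
Arguments ssum {k V} _ {I} _.

Definition strongly_linear (k : comPzRingType) (V W : lmodType k)
    (SV : summability V) (SW : summability W) (phi : {linear V -> W}) : Prop :=
  forall (I : Type) (v : I -> V), summable SV v ->
    summable SW (phi \o v) /\ ssum SW (phi \o v) = phi (ssum SV v).

(* [\sum_(i \in D) F i] from fsbigop.v is the sum of the non-zero [F i] with
   [i] in [D], when there are finitely many of them. *)
Definition min_summability (k : comPzRingType) (V : lmodType k) :
    summability V :=
  {| summable := fun I v => finite_set [set i | v i != 0];
     ssum := fun I v => \sum_(i \in [set: {classic I}]) v i |}.

(** * Non-associative formal power series *)

Inductive magma (I : Type) := Letter of I | Node of magma I & magma I.

(* The free non-associative monoid on [I]: the free magma with an identity
   adjoined. *)
Definition word (I : Type) := option (magma I).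

Definition empty_word (I : Type) : word I := None.

Definition letter (I : Type) (i : I) : word I := Some (Letter i).

Definition word_mul (I : Type) (u v : word I) : word I :=
  match u, v with
  | None, _ => v
  | _, None => u
  | Some s, Some t => Some (Node s t)
  end.

Definition splittings (I : Type) (w : word I) :
    set ({classic word I * word I}) :=
  [set p | word_mul p.1 p.2 = w].

Lemma finite_splittings (I : Type) (w : word I) : finite_set (splittings w).
Proof.
pose e : {classic word I * word I} := (empty_word I, w).
pose f : {classic word I * word I} := (w, empty_word I).
pose g : {classic word I * word I} :=
  if w is Some (Node s t) then (Some s, Some t) else e.
apply: (@sub_finite_set _ _ ([set e] `|` [set f] `|` [set g])); last first.
  by rewrite !finite_setU; split; [split|]; exact: finite_set1.
rewrite /e /f /g => -[[s|] [t|]] /= <-.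
- by right.
- by left; right.
- by left; left.
- by left; left.
Qed.

Definition series (k : comPzRingType) (I : Type) := word I -> k^o.

HB.instance Definition _ (k : comPzRingType) (I : Type) :=
  GRing.Lmodule.copy (series k I) (word I -> k^o).

Section Series.
Variables (k : comPzRingType) (I : Type).
Implicit Types P Q : series k I.

Definition series_mul P Q : series k I :=
  fun w => \sum_(p \in splittings w) ((P p.1 : k) * (Q p.2 : k)).

Let series_mulE P Q w : series_mul P Q w =
  \sum_(p <- fset_set (splittings w)) ((P p.1 : k) * (Q p.2 : k)).
Proof. by rewrite /series_mul fsbig_finite//; exact: finite_splittings. Qed.

Lemma series_mul_linearl Q : linear (series_mul^~ Q).
Proof.
move=> c P P'; apply/funext => w.
rewrite [RHS]/GRing.add/= [in RHS]/GRing.scale/= !series_mulE.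
rewrite [in RHS]/GRing.scale/= big_distrr -big_split/=.
by apply: eq_bigr => p _; rewrite mulrA -mulrDl.
Qed.

Lemma series_mul_linearr P : linear (series_mul P).
Proof.
move=> c Q Q'; apply/funext => w.
rewrite [RHS]/GRing.add/= [in RHS]/GRing.scale/= !series_mulE.
rewrite [in RHS]/GRing.scale/= big_distrr -big_split/=.
by apply: eq_bigr => p _; rewrite mulrCA -mulrDr.
Qed.

HB.instance Definition _ := Lmodule_isNAAlgebra.Build k (series k I)
  series_mul_linearl series_mul_linearr.

Definition series_summability : summability (series k I) :=
  {| summable := fun J (P : J -> series k I) =>
       forall w, finite_set [set j | P j w != 0];
     ssum := fun J (P : J -> series k I) =>
       fun w => \sum_(j \in [set: {classic J}]) P j w |}.

Definition indeterminate (i : I) : series k I :=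
  fun w => (`[< w = letter i >])%:R.

Definition no_constant_term : pred (series k I) :=
  [pred P : series k I | P (empty_word I) == 0].

(* The ideal of series with zero constant term. *)
Record series0 := Series0 {
  series0_val :> series k I;
  series0P : no_constant_term series0_val }.

HB.instance Definition _ := [isSub for series0_val].
HB.instance Definition _ := [Choice of series0 by <:].

Lemma no_constant_term_submod : GRing.subsemimod_closed no_constant_term.
Proof.
split; first split.
- by rewrite inE /=; apply/eqP.
- move=> P Q; rewrite !inE /= => /eqP P0 /eqP Q0; apply/eqP.
  by rewrite [LHS]/GRing.add/= P0 Q0 addr0.
- move=> c P; rewrite !inE /= => /eqP P0; apply/eqP.
  by rewrite [LHS]/GRing.scale/= P0 scaler0.
Qed.

HB.instance Definition _ :=
  GRing.SubChoice_isSubLmodule.Build k (series k I) no_constant_term series0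
    no_constant_term_submod.

Lemma no_constant_term_mul P Q :
  no_constant_term P -> no_constant_term (series_mul P Q).
Proof.
move=> /eqP P0; apply/eqP; rewrite /series_mul fsbig1// => -[[s|] [t|]] //= _.
by rewrite P0 mul0r.
Qed.

Definition series0_mul (P Q : series0) : series0 :=
  Series0 (no_constant_term_mul Q (series0P P)).

Lemma series0_mul_linearl (Q : series0) : linear (series0_mul^~ Q).
Proof. by move=> c P P'; apply/val_inj/series_mul_linearl. Qed.

Lemma series0_mul_linearr (P : series0) : linear (series0_mul P).
Proof. by move=> c Q Q'; apply/val_inj/series_mul_linearr. Qed.

HB.instance Definition _ := Lmodule_isNAAlgebra.Build k series0
  series0_mul_linearl series0_mul_linearr.

Lemma no_constant_term_indeterminate i : no_constant_term (indeterminate i).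
Proof. by apply/eqP; rewrite /indeterminate asboolF. Qed.

Definition indeterminate0 (i : I) : series0 :=
  Series0 (no_constant_term_indeterminate i).

Lemma no_constant_term_ssum (J : Type) (P : J -> series0) :
  no_constant_term (ssum series_summability (series0_val \o P)).
Proof. by apply/eqP; rewrite /= fsbig1// => j _; apply/eqP/series0P. Qed.

Definition series0_summability : summability series0 :=
  {| summable := fun J (P : J -> series0) =>
       summable series_summability (series0_val \o P);
     ssum := fun J (P : J -> series0) => Series0 (no_constant_term_ssum P) |}.

End Series.

Definition has_evaluations (k : comPzRingType) (A : naAlgType k)
    (S : summability A) : Prop :=
  forall (I : Type) (a : I -> A), summable S a ->
    exists ev : {linear series0 k I -> A},
      [/\ strongly_linear (series0_summability k I) S ev,
          namultiplicative ev
        & forall i, ev (indeterminate0 k i) = a i].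

(* Main.v *)
Require Import Defs.
From HB Require Import structures.
From mathcomp Require Import all_boot all_order all_algebra.
From mathcomp Require Import finmap.
From mathcomp Require Import boolp classical_sets functions cardinality fsbigop.
From mathcomp Require Import zify.

(* Write [a^t] for the value in [A] of a non-associative monomial [t] at a
   family [a].  If [A] has evaluations, apply them to a family [a] whose
   non-zero values are the finitely many generators of a subalgebra [B]. The
   family of all monomials is summable in the power series algebra, so its
   image [t |-> a^t] is finitely supported: [a^t = 0] once [t] is long enough,
   and such [a^t] generate the high powers of [B].
   Conversely, if [A] is locally nilpotent and [a] is finitely supported, then
   the range of [a] generates a nilpotent subalgebra, so [a^t = 0] for all long
   [t]; there remain finitely many [t], and [P |-> \sum_t P(t) a^t] is a finite
   sum. *)

Set Implicit Arguments.
Unset Strict Implicit.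
Unset Printing Implicit Defensive.

Import GRing.Theory.

Local Open Scope classical_set_scope.
Local Open Scope ring_scope.

(** * Sizes of non-associative words *)

Section Magma.
Variable I : Type.

Fixpoint magma_size (t : magma I) : nat :=
  match t with
  | Letter _ => 1
  | Node s t => magma_size s + magma_size t
  end.

Lemma magma_size_gt0 t : (0 < magma_size t)%N.
Proof. by elim: t => //= s IHs t _; rewrite addn_gt0 IHs. Qed.

End Magma.

(** * Bilinearity of the product *)

Section Bilinear.
Variables (k : comPzRingType) (A : naAlgType k).
Implicit Types (a b x y : A) (c : k).

Lemma namulDl a b x : namul (a + b) x = namul a x + namul b x.
Proof. by have := namul_linearl x 1 a b; rewrite !scale1r. Qed.

Lemma namulDr a b x : namul x (a + b) = namul x a + namul x b.
Proof. by have := namul_linearr x 1 a b; rewrite !scale1r. Qed.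

Lemma namul0l x : namul 0 x = 0.
Proof. by apply: (@addrI _ (namul 0 x)); rewrite -namulDl !addr0. Qed.

Lemma namul0r x : namul x 0 = 0.
Proof. by apply: (@addrI _ (namul x 0)); rewrite -namulDr !addr0. Qed.

Lemma namulZl c a x : namul (c *: a) x = c *: namul a x.
Proof. by have := namul_linearl x c a 0; rewrite namul0l !addr0. Qed.

Lemma namulZr c a x : namul x (c *: a) = c *: namul x a.
Proof. by have := namul_linearr x c a 0; rewrite namul0r !addr0. Qed.

Lemma namul_suml J (s : seq J) (F : J -> A) x :
  namul (\sum_(j <- s) F j) x = \sum_(j <- s) namul (F j) x.
Proof.
by apply: (big_morph (namul^~ x)) => [a b|]; [exact: namulDl|exact: namul0l].
Qed.

Lemma namul_sumr J (s : seq J) (F : J -> A) x :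
  namul x (\sum_(j <- s) F j) = \sum_(j <- s) namul x (F j).
Proof.
by apply: (big_morph (namul x)) => [a b|]; [exact: namulDr|exact: namul0r].
Qed.

End Bilinear.

(** * Powers of a subalgebra *)

Section AlgPower.
Variables (k : comPzRingType) (A : naAlgType k).
Implicit Types (B M S : set A).

Lemma submodule_smallest (C : set A -> Prop) S :
  (forall M, C M -> submodule M) -> submodule (smallest C S).
Proof.
move=> sub; split=> [M [/sub[]] //|x y Sx Sy M CM|c x Sx M CM].
- by have [_ + _] := sub _ CM.1; apply; [exact: Sx|exact: Sy].
- by have [_ _] := sub _ CM.1; apply; exact: Sx.
Qed.

Lemma submodule_gen_submodule S : submodule (submodule_gen S).
Proof. exact: submodule_smallest. Qed.

Lemma subalgebra_gen_subalgebra S : subalgebra (subalgebra_gen S).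
Proof.
split; first by apply: submodule_smallest => M [].
by move=> x y Sx Sy M CM; apply: CM.1.2; [exact: Sx|exact: Sy].
Qed.

Lemma alg_power_submodule B n :
  submodule B -> (0 < n)%N -> submodule (alg_power B n).
Proof.
case: n => [//|[|n]] sB _; first by rewrite alg_power1.
by rewrite alg_powerS//; exact: submodule_gen_submodule.
Qed.

Lemma alg_powerM B m n x y : alg_power B m x -> alg_power B n y ->
  (0 < m)%N -> (0 < n)%N -> alg_power B (m + n) (namul x y).
Proof.
case: m n => [//|m] [//|n] Bx By _ _; rewrite addSn.
by apply: (alg_power_mul (i := m.+1)) => //; [lia|rewrite subSS addKn].
Qed.

(** Strong induction on [n]: in a generator of weight [n.+1], a factor of weight above 1 also has
    weight one less by induction. If both factors have weight 1, then [n = 1] and closure of [B]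
    under products suffices. *)
Lemma alg_powerS_sub B n : subalgebra B -> (0 < n)%N ->
  alg_power B n.+1 `<=` alg_power B n.
Proof.
move=> [sB mB]; elim/ltn_ind: n => n IH n0; rewrite alg_powerS//.
(* Symmetric in [i] and [j], so that it serves both orders of the product. *)
have step i a j b : (0 < i)%N -> (0 < j)%N -> (i + j = n.+1)%N ->
    alg_power B i a -> alg_power B j b -> alg_power B n (namul a b).
  move=> i0 j0 ij Ba Bb; have [i1|i1] := ltnP 1 i.
    have -> : (n = i.-1 + j)%N by lia.
    by apply: alg_powerM => //; [apply: IH; rewrite ?prednK//; lia|lia].
  have [j1|j1] := ltnP 1 j.
    have -> : (n = i + j.-1)%N by lia.
    by apply: alg_powerM => //; [apply: IH; rewrite ?prednK//; lia|lia].
  have [E1 [E2 E3]] : i = 1%N /\ j = 1%N /\ n = 1%N by lia.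
  by move: Ba Bb; rewrite E1 E2 E3 alg_power1; exact: mB.
apply: smallest_sub; first exact: alg_power_submodule.
by move=> _ [i [a [b [hi Ba Bb [->|->]]]]];
  [apply: (step i _ (n.+1 - i)%N)|apply: (step (n.+1 - i)%N _ i)] => //; lia.
Qed.

Lemma alg_power_antitone B m n : subalgebra B -> (0 < m <= n)%N ->
  alg_power B n `<=` alg_power B m.
Proof.
move=> sB /andP[m0 /subnK <-]; elim: (n - m)%N => [|d IH] //.
apply: subset_trans IH; rewrite addSn; apply: alg_powerS_sub => //; lia.
Qed.

End AlgPower.

(** * Values of monomials in the algebra *)

Section MagmaEval.
Variables (k : comPzRingType) (A : naAlgType k) (I : Type) (a : I -> A).
Implicit Types (s t : magma I).

Fixpoint magma_eval t : A :=
  match t with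
  | Letter i => a i
  | Node s t => namul (magma_eval s) (magma_eval t)
  end.

Lemma magma_eval_alg_power (B : set A) t :
  (forall i, B (a i)) -> alg_power B (magma_size t) (magma_eval t).
Proof.
move=> Ba; elim: t => [i|s IHs t IHt] /=; first exact: alg_power_1.
by apply: alg_powerM => //; exact: magma_size_gt0.
Qed.

(** The size is at least [n], not exactly [n], because the first power of [B] is all of [B] and so
    contains monomials of every size. *)
Definition magma_span n : set A :=
  submodule_gen (magma_eval @` [set t | (n <= magma_size t)%N]).

(** Bilinearity reduces first [x], then [y], to the value of a monomial; sizes add under [Node]. *)
Lemma magma_spanM m n x y : magma_span m x -> magma_span n y ->
  magma_span (m + n) (namul x y).
Proof.
have [N0 ND NZ] := submodule_gen_submodule
  (magma_eval @` [set t | (m + n <= magma_size t)%N]).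
move=> Mx My; move: x Mx; apply: smallest_sub.
  split=> [|x x'|c x]; rewrite /= ?namul0l ?namulDl ?namulZl //.
  - exact: ND.
  - exact: NZ.
move=> _ [s /= hs <-]; move: y My; apply: smallest_sub.
  split=> [|y y'|c y]; rewrite /= ?namul0r ?namulDr ?namulZr //.
  - exact: ND.
  - exact: NZ.
move=> _ [t /= ht <-]; apply: sub_gen_smallest; exists (Node s t) => //=.
exact: leq_add.
Qed.

(** Induction on the derivation of [alg_power]. The base case holds because [magma_span 1] is a
    subalgebra containing [S]. *)
Lemma alg_power_magma_span (S : set A) n : S `<=` range a -> (0 < n)%N ->
  alg_power (subalgebra_gen S) n `<=` magma_span n.
Proof.
move=> Sa + x Bx; elim: Bx => {n x}.
- move=> x Bx _; apply: (Bx (magma_span 1)); split.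
    split; first exact: submodule_gen_submodule.
    move=> u v Mu Mv; apply: smallest_sub (magma_spanM Mu Mv).
      exact: submodule_gen_submodule.
    by move=> _ [t _ <-]; apply: sub_gen_smallest; exists t => //;
      exact: magma_size_gt0.
  by move=> _ /Sa[i _ <-]; apply: sub_gen_smallest; exists (Letter i).
- move=> n i x y hi _ IHx _ IHy _.
  have -> : (n.+1 = i + (n.+1 - i))%N by lia.
  by apply: magma_spanM; [apply: IHx|apply: IHy]; lia.
- move=> n i x y hi _ IHx _ IHy _.
  have -> : (n.+1 = (n.+1 - i) + i)%N by lia.
  by apply: magma_spanM; [apply: IHy|apply: IHx]; lia.
- by move=> n _ _; have [] := submodule_gen_submodule
    (magma_eval @` [set t | (n.+1 <= magma_size t)%N]).
- move=> n x y _ _ IHx _ IHy _; have [_ + _] := submodule_gen_submodule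
    (magma_eval @` [set t | (n.+1 <= magma_size t)%N]).
  by apply; [exact: IHx|exact: IHy].
- move=> n c x _ _ IHx _; have [_ _] := submodule_gen_submodule
    (magma_eval @` [set t | (n.+1 <= magma_size t)%N]).
  by apply; exact: IHx.
Qed.

Lemma nilpotent_magma_eval (S : set A) : S `<=` range a ->
  finite_set [set t | magma_eval t != 0] -> nilpotent (subalgebra_gen S).
Proof.
move=> Sa finE.
have [m mE] : exists m, forall t, magma_eval t != 0 -> (magma_size t <= m)%N.
  have [X defX] := finite_fsetP.1
    (finite_image (@magma_size I) finE).
  exists (\max_(n <- X) n)%N => t t0.
  apply: leq_bigmax_seq => //.
  have : [set` X] (magma_size t) by rewrite -defX; exists t.
  by [].
(* The bound [m] may be 0 while nilpotency asks for a positive index, hence [m.+1]. *)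
exists m.+1 => //; apply/seteqP; split=> x; last first.
  by move=> ->; exact: alg_power_0.
move/(alg_power_magma_span Sa (ltn0Sn _)); apply: smallest_sub.
  by split=> [//|u v -> ->|c u ->]; rewrite /= ?addr0 ?scaler0.
move=> _ [t /= ht <-]; apply: contrapT => /eqP /mE; lia.
Qed.

(** The alphabet may be infinite, so bounding the size is not enough. A node with non-zero value has
    two strictly smaller factors with non-zero values, which gives an induction on [m]. *)
Lemma finite_magma_eval m : finite_set [set i | a i != 0] ->
  finite_set [set t | (magma_size t <= m)%N /\ magma_eval t != 0].
Proof.
move=> fina; elim: m => [|m IH].
  by apply: sub_finite_set (finite_set0 _) => t [+ _]; have := magma_size_gt0 t; lia.
apply: (@sub_finite_set _ _ (@Letter I @` [set i | a i != 0] `|`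
  [set Node s t | s in [set t | (magma_size t <= m)%N /\ magma_eval t != 0] &
     t in [set t | (magma_size t <= m)%N /\ magma_eval t != 0]])); last first.
  by rewrite finite_setU; split; [exact: finite_image|exact: finite_image2].
move=> [i|s t] [/= sz e0]; [by left; exists i|right].
have := magma_size_gt0 s; have := magma_size_gt0 t => t0 s0.
exists s; [split; first lia|exists t => //; split; first lia].
- by apply: contraNneq e0 => ->; rewrite namul0l.
- by apply: contraNneq e0 => ->; rewrite namul0r.
Qed.

End MagmaEval.

(** * Monomials in the power series algebra *)

Section Monomials.
Variables (k : comPzRingType) (I : Type).
Implicit Types (P Q : series0 k I) (s t : magma I).

Definition magma_coef P t : k := series0_val P (Some t).

Lemma series0_mul_letter P Q i :
  magma_coef (namul P Q) (Letter i) = 0.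
Proof.
have /eqP P0 := series0P P; have /eqP Q0 := series0P Q.
rewrite /magma_coef /= /series_mul fsbig1// => -[[s|] [t|]] //= _.
- by rewrite Q0 mulr0.
- by rewrite P0 mul0r.
Qed.

(** Besides [(s, t)], the word [Node s t] splits only with an empty factor, and there a constant
    term, equal to 0, appears. *)
Lemma series0_mul_node P Q s t :
  magma_coef (namul P Q) (Node s t) = magma_coef P s * magma_coef Q t.
Proof.
have /eqP P0 := series0P P; have /eqP Q0 := series0P Q.
rewrite /magma_coef /= /series_mul.
pose p : {classic word I * word I} := (Some s, Some t).
rewrite -(@fsbig_widen _ _ _ _ [set p]) ?fsbig_set1//.
- by move=> _ ->.
- move=> [[u|] [v|]] [] //= E np.
  + by case: E np => -> -> np; exfalso; exact: np.
  + by rewrite Q0 mulr0.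
  + by rewrite P0 mul0r.
Qed.

Definition monomial t : series k I := fun w => `[< w = Some t >]%:R.

Lemma no_constant_term_monomial t : no_constant_term (monomial t).
Proof. by apply/eqP; rewrite /monomial asboolF. Qed.

Definition monomial0 t : series0 k I := Series0 (no_constant_term_monomial t).

Lemma monomial0_letter i : monomial0 (Letter i) = indeterminate0 k i.
Proof. exact: val_inj. Qed.

Lemma monomial0_node s t :
  monomial0 (Node s t) = namul (monomial0 s) (monomial0 t).
Proof.
apply: val_inj; apply/funext => -[[i|u v]|].
- by rewrite [RHS]series0_mul_letter /= /monomial asboolF.
- rewrite [RHS]series0_mul_node /= /monomial -natrM mulnb -asbool_and.
  by congr ((nat_of_bool _)%:R); apply: asbool_equiv_eq; split=> [[-> ->]|[[->] [->]]].
- by rewrite [RHS](eqP (series0P (namul _ _))) /= /monomial asboolF.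
Qed.

Lemma summable_monomial0 : summable (series0_summability k I) monomial0.
Proof.
move=> w /=; case: w => [t|].
  apply: sub_finite_set (finite_set1 t) => s /=; apply: contraNP => st.
  by rewrite /monomial asboolF// => -[E]; apply: st.
by apply: sub_finite_set (finite_set0 _) => s /=; rewrite /monomial asboolF// eqxx.
Qed.

Lemma namultiplicative_monomial0 (A : naAlgType k)
    (phi : {linear series0 k I -> A}) (a : I -> A) t :
  namultiplicative phi -> (forall i, phi (indeterminate0 k i) = a i) ->
  phi (monomial0 t) = magma_eval a t.
Proof.
move=> phiM phiX; elim: t => [i|s IHs t IHt] /=.
  by rewrite monomial0_letter phiX.
by rewrite monomial0_node phiM IHs IHt.
Qed.

End Monomials.

(** [D] may exceed the support of [F], so one finite [D] can serve several families at once and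
    their sums can be exchanged. *)
Lemma fsumT_fset_set (V : nmodType) (T : choiceType) (D : set T) (F : T -> V) :
  finite_set D -> (forall i, ~ D i -> F i = 0) ->
  \sum_(i \in [set: T]) F i = \sum_(i <- fset_set D) F i.
Proof.
move=> finD F0; rewrite -fsbig_finite//.
by apply/esym/fsbig_widen => // i [_ /F0].
Qed.

(** * The evaluation map as a finite sum *)

Section SeriesEval.
Variables (k : comPzRingType) (A : naAlgType k) (I : Type) (a : I -> A).
Variable s : seq {classic magma I}.

Definition series_eval (P : series0 k I) : A :=
  \sum_(t <- s) magma_coef P t *: magma_eval a t.

Lemma series_eval_linear : linear series_eval.
Proof.
move=> c P Q; rewrite /series_eval scaler_sumr -big_split /=.
by apply: eq_bigr => t _; rewrite scalerA -scalerDl.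
Qed.

HB.instance Definition _ :=
  GRing.isLinear.Build k (series0 k I) A *:%R series_eval series_eval_linear.

Lemma strongly_linear_series_eval :
  strongly_linear (series0_summability k I) (min_summability A) series_eval.
Proof.
move=> J v sv.
(* Only coefficients at words of [s] matter. As [s] is finite, [D] is a finite union of finite sets,
   and it contains the support of each of these coefficient families. *)
pose D : set {classic J} := \bigcup_(t in [set` s]) [set j | magma_coef (v j) t != 0].
have finD : finite_set D.
  by apply: bigcup_finite => [|t _]; [exact: finite_seq|exact: sv].
have notD j t : ~ D j -> t \in s -> magma_coef (v j) t = 0.
  by move=> Dj ts; apply: contrapT => /eqP v0; apply: Dj; exists t.
have evD j : ~ D j -> series_eval (v j) = 0.
  move=> Dj; rewrite /series_eval big_seq big1// => t ts.
  by rewrite (notD j)// scale0r.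
split=> /=; first by apply: sub_finite_set finD => j /=; apply: contraNP => /evD ->.
rewrite (@fsumT_fset_set A _ D)//= exchange_big /=; apply: eq_big_seq => t ts.
rewrite -scaler_suml; congr (_ *: _); apply/esym.
by apply: (@fsumT_fset_set k^o) => // j Dj; exact: notD.
Qed.

Hypotheses (s_uniq : uniq s).
Hypothesis s_supp : forall t, magma_eval a t != 0 -> t \in s.

(** Both sides are brought to the sum of [g (Node u v)] over all pairs [u], [v] in [s]. *)
Lemma series_eval_mul : namultiplicative series_eval.
Proof.
move=> P Q; rewrite /= /series_eval namul_suml.
pose g (w : {classic magma I}) := magma_coef (namul P Q) w *: magma_eval a w.
(* The detour through all words is made because [Node u v] need not lie in [s] when [u] and [v]
   do. *)
have -> : \sum_(t <- s) magma_coef (namul P Q) t *: magma_eval a t =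
    \sum_(w \in [set: {classic magma I}]) g w.
  rewrite fsbig_seq//; apply: fsbig_widen => // w [_ ws] /=.
  by rewrite /g; have [->|/s_supp/ws] // := eqVneq (magma_eval a w) 0; rewrite scaler0.
pose node (p : {classic magma I} * {classic magma I}) : {classic magma I} :=
  Node p.1 p.2.
(* No other word contributes: letters have coefficient 0 in a product, and both factors of a node
   with non-zero value have non-zero values, hence lie in [s]. *)
rewrite -(@fsbig_widen _ _ _ _ (node @` ([set` s] `*` [set` s]))) => [|//|]; last first.
  move=> [i|u v] [_ nI] /=; first by rewrite /g series0_mul_letter scale0r.
  rewrite /g; have [->|uv0] := eqVneq (magma_eval a (Node u v)) 0; first exact: scaler0.
  exfalso; apply: nI; exists (u, v) => //; split=> /=; apply: s_supp.
  - by apply: contraNneq uv0 => /= ->; rewrite namul0l.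
  - by apply: contraNneq uv0 => /= ->; rewrite namul0r.
rewrite fsbig_image => [|[u v] [u' v'] _ _ [-> ->]//].
have fins := finite_seq s.
rewrite -(@pair_fsbig _ _ _ {classic magma I} {classic magma I} _ _
  (fun u v => g (Node u v)))//.
rewrite -fsbig_seq//; apply: eq_bigr => u _.
rewrite -fsbig_seq// namul_sumr; apply: eq_bigr => v _.
by rewrite /g series0_mul_node /= namulZl namulZr scalerA.
Qed.

Lemma series_eval_indeterminate i : series_eval (indeterminate0 k i) = a i.
Proof.
rewrite /series_eval fsbig_seq//.
pose l : {classic magma I} := Letter i.
have F t : t <> l -> magma_coef (indeterminate0 k i) t *: magma_eval a t = 0.
  by move=> tl; rewrite /= /indeterminate asboolF ?scale0r// => -[].
have Fl : magma_coef (indeterminate0 k i) l *: magma_eval a l = a i.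
  by rewrite /= /indeterminate asboolT// scale1r.
have [ls|ls] := boolP (l \in s).
  rewrite -(@fsbig_widen _ _ _ _ [set l]) ?fsbig_set1//.
  - by move=> _ ->.
  - by move=> t [_ /F].
(* If the letter is missing from [s], then [a i = 0] by [s_supp], and the sum vanishes too. *)
rewrite fsbig1 => [|t ts].
  by have [->//|/(@s_supp l)] := eqVneq (a i) 0; rewrite (negbTE ls).
by apply: F => tl; move: ls; rewrite -tl ts.
Qed.

End SeriesEval.

(** * The two implications *)

Lemma has_evaluations_locally_nilpotent (k : comPzRingType) (A : naAlgType k) :
  has_evaluations (min_summability A) -> locally_nilpotent A.
Proof.
move=> evA _ [S finS ->].
(* The generators are indexed by [A] itself and extended by 0, so the support lies in the finite set
   [S]. *)
pose a (x : A) : A := if `[< S x >] then x else 0.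
have [|ev [evS evM evX]] := evA A a.
  by apply: sub_finite_set finS => x; rewrite /= /a; case: asboolP => //; rewrite eqxx.
apply: (@nilpotent_magma_eval _ _ _ a).
  by move=> x Sx; exists x => //; rewrite /a asboolT.
(* Summability of the image in the minimal structure is precisely finiteness of the set of monomials
   with non-zero value. *)
have [+ _] := evS _ _ (@summable_monomial0 k A).
by apply: sub_finite_set => t; rewrite /= (namultiplicative_monomial0 t evM evX).
Qed.

Lemma locally_nilpotent_has_evaluations (k : comPzRingType) (A : naAlgType k) :
  locally_nilpotent A -> has_evaluations (min_summability A).
Proof.
move=> nilA I a /= fina.
have finE : finite_set [set t : {classic magma I} | magma_eval a t != 0].
  have finS : finite_set (range a).
    apply: (@sub_finite_set _ _ (a @` [set i | a i != 0] `|` [set 0])); last first.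
      by rewrite finite_setU; split=> //; exact: finite_image.
    move=> _ [i _ <-]; have [->|ai] := eqVneq (a i) 0; [by right|by left; exists i].
  have [m m0 Bm] := nilA (subalgebra_gen (range a)) (ex_intro2 _ _ _ finS erefl).
  apply: sub_finite_set (finite_magma_eval m fina) => t /= t0; split=> //.
  rewrite leqNgt; apply: contraNN t0 => ht; apply/eqP.
  suff : alg_power (subalgebra_gen (range a)) m.+1 (magma_eval a t) by rewrite Bm.
  (* The value of [t] lies in the power indexed by its size, which exceeds [m], and the powers
     decrease. *)
  apply: (@alg_power_antitone _ _ _ _ (magma_size t)) => //.
    exact: subalgebra_gen_subalgebra.
  by apply: magma_eval_alg_power => i; apply: sub_gen_smallest; exists i.
pose s := fset_set [set t : {classic magma I} | magma_eval a t != 0].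
have s_supp (t : {classic magma I}) : magma_eval a t != 0 -> t \in (s : seq _).
  by move=> t0; rewrite in_fset_set//; apply/mem_set.
exists (series_eval a s); split.
- exact: strongly_linear_series_eval.
- exact: (series_eval_mul (fset_uniq _) s_supp).
- exact: (series_eval_indeterminate (fset_uniq _) s_supp).
Qed.

Theorem proposition3p25 (k : comPzRingType) (iota : {rmorphism rat -> k})
  (A : naAlgType k) :
  has_evaluations (min_summability A) <-> locally_nilpotent A.
Proof.
split; first exact: has_evaluations_locally_nilpotent.
exact: locally_nilpotent_has_evaluations.
Qed.
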